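(* Let $U\subset\mathbb{R}^N$ be open, let $\{\beta_{ij}\}_{i\neq j}$ be smooth real functions on $U$ with $\frac{\partial\beta_{ij}}{\partial u_k}=\beta_{ik}\beta_{kj}$ for $i,j,k$ pairwise different and $\beta_{ij}=\beta_{ji}$ for $i\neq j$, and let $X_i:U\to\mathbb{R}^D$, $H_i:U\to\mathbb{R}$, $x:U\to\mathbb{R}^D$ be smooth with $\frac{\partial X_j}{\partial u_i}=\beta_{ji}X_i$, $\frac{\partial H_j}{\partial u_i}=\beta_{ij}H_i$ $(i\ne j)$ and $\frac{\partial x}{\partial u_i}=X_iH_i$. Let $V_1,V_2$ be finite-dimensional real coordinate spaces, and for $s=1,2$ let $\xi_{i,(s)}:U\to V_s$ be smooth with $\frac{\partial\xi_{j,(s)}}{\partial u_i}=\beta_{ji}\xi_{i,(s)}$ $(i\neq j)$, $L_{(s)}$ a linear operator on $V_s$, and $\xi^*_{i,(s)}:=\xi_{i,(s)}^{\mathrm t}L_{(s)}$. Let $\Omega_{st}:=\Omega(\xi_{(s)},\xi_{(t)}^* )$, $\Omega(X,\xi_{(s)}^* )$, $\Omega(\xi_{(s)},H)$ be potentials. Put $$\xi_i=\begin{pmatrix}\xi_{i,(1)}\\ \xi_{i,(2)}\end{pmatrix},\quad L=\begin{pmatrix}L_{(1)}&0\\0&L_{(2)}\end{pmatrix},\quad \Omega=\begin{pmatrix}\Omega_{11}&\Omega_{12}\\ \Omega_{21}&\Omega_{22}\end{pmatrix},$$ and suppose $L^{\mathrm t}\Omega=\Omega^{\mathrm t}L$ and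 that $\Omega$ and $\Omega_{22}$ are invertible on $U$. Then the vectorial symmetric fundamental transformation with data $(V_1\oplus V_2,\xi_i,L)$ coincides with the following composition of vectorial symmetric fundamental transformations: 1. First transform with data $(V_2,\xi_{i,(2)},L_{(2)})$, and denote the result by ${}'$. 2. On the result apply the transformation with data $(V_1,\xi'_{i,(1)},L_{(1)})$. That is: the data in steps 1 and 2 satisfy the requirements of a vectorial symmetric fundamental transformation, and the transformed rotation coefficients $\hat\beta_{ij}$, tangent vectors $\hat X_i$, Lamé coefficients $\hat H_i$ and points $\hat x$ obtained from the data $(V_1\oplus V_2,\xi_i,L)$ equal those obtained by performing step 1 and then step 2.
   Context: Vectors are columns, covectors are rows, ${}^{\mathrm t}$ is transpose. Given $\beta_{ij}$, column-valued $\eta_i:U\to V$ with $\frac{\partial\eta_j}{\partial u_i}=\beta_{ji}\eta_i$ and row-valued $\theta_i^*:U\to W^*$ with $\frac{\partial\theta^*_j}{\partial u_i}=\beta_{ij}\theta_i^*$ $(i\neq j)$, a potential $\Omega(\eta,\theta^* )$ is a smooth function with values in linear maps $W\to V$ with $\frac{\partial\Omega(\eta,\theta^* )}{\partial u_i}=\eta_i\theta_i^*$ for all $i$. It is defined up to an additive constant. The vectorial symmetric fundamental transformation with data $(V,\xi_i,L)$, where $\beta$ is symmetric, $\xi_i:U\to V$ solves $\frac{\partial\xi_j}{\partial u_i}=\beta_{ji}\xi_i$ $(i\neq j)$, $L$ is a linear operator on $V$, $\xi_i^*:=\xi_i^{\mathrm t}L$, and the potential $\Omega(\xi,\xi^*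 )$ is invertible and satisfies $L^{\mathrm t}\Omega(\xi,\xi^* )=\Omega(\xi,\xi^* )^{\mathrm t}L$, is $$\hat\beta_{ij}=\beta_{ij}-\xi_j^*\Omega(\xi,\xi^* )^{-1}\xi_i,\qquad \hat X_i=X_i-\Omega(X,\xi^* )\Omega(\xi,\xi^* )^{-1}\xi_i,$$ $$\hat H_i=H_i-\xi_i^*\Omega(\xi,\xi^* )^{-1}\Omega(\xi,H),\qquad \hat x=x-\Omega(X,\xi^* )\Omega(\xi,\xi^* )^{-1}\Omega(\xi,H).$$ For the data $(V_1\oplus V_2,\xi_i,L)$ one uses $\Omega(\xi,\xi^* )=\Omega$, $\Omega(X,\xi^* )=(\Omega(X,\xi^*_{(1)}),\Omega(X,\xi^*_{(2)}))$ and $\Omega(\xi,H)=\begin{pmatrix}\Omega(\xi_{(1)},H)\\ \Omega(\xi_{(2)},H)\end{pmatrix}$. In step 1 one uses $\Omega(\xi_{(2)},\xi_{(2)}^* )=\Omega_{22}$ and the given potentials $\Omega(X,\xi_{(2)}^* )$, $\Omega(\xi_{(2)},H)$. The first transformation also acts on the remaining data by $$\xi'_{i,(1)}=\xi_{i,(1)}-\Omega_{12}\Omega_{22}^{-1}\xi_{i,(2)},\qquad \xi'^*_{i,(1)}=\xi^*_{i,(1)}-\xi^*_{i,(2)}\Omega_{22}^{-1}\Omega_{21}.$$ In step 2 the requirements are those listed above for $\beta'$, $\xi'_{i,(1)}$, $L_{(1)}$ (in particular $\xi'^*_{i,(1)}=\xi'^{\mathrm t}_{i,(1)}L_{(1)}$),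 and the potentials used are the transformed ones: $$\Omega(\xi'_{(1)},\xi'^*_{(1)})=\Omega_{11}-\Omega_{12}\Omega_{22}^{-1}\Omega_{21},\quad \Omega(X',\xi'^*_{(1)})=\Omega(X,\xi^*_{(1)})-\Omega(X,\xi^*_{(2)})\Omega_{22}^{-1}\Omega_{21},$$ $$\Omega(\xi'_{(1)},H')=\Omega(\xi_{(1)},H)-\Omega_{12}\Omega_{22}^{-1}\Omega(\xi_{(2)},H).$$ *)

(* Defs.v *)
From HB Require Import structures.
From mathcomp Require Import all_boot all_order all_algebra.
From mathcomp Require Import all_classical all_reals all_analysis.

Set Implicit Arguments.
Unset Strict Implicit.
Unset Printing Implicit Defensive.
Import Order.TTheory GRing.Theory Num.Theory.
Import numFieldNormedType.Exports.
Local Open Scope classical_set_scope.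
Local Open Scope ring_scope.

Section Calculus.
Context {R : realType} {N : nat}.

Definition pd {W : normedModType R} (i : 'I_N) (f : 'cV[R]_N -> W) :
  'cV[R]_N -> W := 'D_(delta_mx i 0) f.

(* Only meant for open U; functions are total, their values outside U are
   irrelevant. *)
Fixpoint Ck {W : normedModType R} (U : set 'cV[R]_N) (k : nat)
    (f : 'cV[R]_N -> W) : Prop :=
  (forall u, U u -> {for u, continuous f}) /\
  (if k is k'.+1 then
     forall i, (forall u, U u -> derivable f u (delta_mx i 0)) /\
               Ck U k' (pd i f)
   else True).

Definition smooth {W : normedModType R} (U : set 'cV[R]_N)
  (f : 'cV[R]_N -> W) : Prop := forall k, Ck U k f.

End Calculus.

(* Throughout, the diagonal coefficients beta i i are meaningless and never
   constrained. *)
Section LinearSystems.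
Context {R : realType} {N : nat}.
Variables (U : set 'cV[R]_N) (beta : 'I_N -> 'I_N -> 'cV[R]_N -> R).

Definition darboux : Prop :=
  forall i j k, i != j -> j != k -> i != k ->
    forall u, U u -> pd k (beta i j) u = beta i k u * beta k j u.

Definition symmetric_coeffs : Prop :=
  forall i j, i != j -> forall u, U u -> beta i j u = beta j i u.

Definition direct_system {W : normedModType R}
    (eta : 'I_N -> 'cV[R]_N -> W) : Prop :=
  (forall i, smooth U (eta i)) /\
  forall i j, i != j -> forall u, U u ->
    pd i (eta j) u = beta j i u *: eta i u.

Definition adjoint_system {W : normedModType R}
    (theta : 'I_N -> 'cV[R]_N -> W) : Prop :=
  (forall i, smooth U (theta i)) /\
  forall i j, i != j -> forall u, U u ->
    pd i (theta j) u = beta i j u *: theta i u.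

End LinearSystems.

Section Transformation.
Context {R : realType} {N : nat}.

Definition potential {m n : nat} (U : set 'cV[R]_N)
    (eta : 'I_N -> 'cV[R]_N -> 'cV[R]_m)
    (theta : 'I_N -> 'cV[R]_N -> 'rV[R]_n)
    (Om : 'cV[R]_N -> 'M[R]_(m, n)) : Prop :=
  smooth U Om /\
  forall i u, U u -> pd i Om u = eta i u *m theta i u.

(* A scalar family seen as a family of covectors on the line, so that
   potentials Omega(eta, H) are column-valued. *)
Definition as_row (H : 'I_N -> 'cV[R]_N -> R) (i : 'I_N) (u : 'cV[R]_N) :
  'rV[R]_1 := (H i u)%:M.

(* xi^*_i = xi_i^T L *)
Definition star {m : nat} (xi : 'I_N -> 'cV[R]_N -> 'cV[R]_m) (L : 'M[R]_m)
  (i : 'I_N) (u : 'cV[R]_N) : 'rV[R]_m := (xi i u)^T *m L.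

Record net (D : nat) := Net {
  rotation : 'I_N -> 'I_N -> 'cV[R]_N -> R;
  tangent : 'I_N -> 'cV[R]_N -> 'cV[R]_D;
  lame : 'I_N -> 'cV[R]_N -> R;
  position : 'cV[R]_N -> 'cV[R]_D }.

Record is_net {D : nat} (U : set 'cV[R]_N) (S : net D) : Prop := IsNet {
  rotation_smooth : forall i j, i != j -> smooth U (rotation S i j);
  rotation_darboux : darboux U (rotation S);
  tangent_system : direct_system U (rotation S) (tangent S);
  lame_system : adjoint_system U (rotation S) (lame S);
  (* d x / d u_i = X_i H_i *)
  position_potential : potential U (tangent S) (as_row (lame S)) (position S) }.

(* Oxx = Omega(xi, xi^* ), OX = Omega(X, xi^* ), OH = Omega(xi, H) *)
Record vsft_requirements {D m : nat} (U : set 'cV[R]_N) (S : net D)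
    (xi : 'I_N -> 'cV[R]_N -> 'cV[R]_m) (L : 'M[R]_m)
    (Oxx : 'cV[R]_N -> 'M[R]_m) (OX : 'cV[R]_N -> 'M[R]_(D, m))
    (OH : 'cV[R]_N -> 'cV[R]_m) : Prop := VsftRequirements {
  vsft_symmetric : symmetric_coeffs U (rotation S);
  vsft_system : direct_system U (rotation S) xi;
  vsft_potential : potential U xi (star xi L) Oxx;
  vsft_potential_tangent : potential U (tangent S) (star xi L) OX;
  vsft_potential_lame : potential U xi (as_row (lame S)) OH;
  vsft_invertible : forall u, U u -> Oxx u \in unitmx;
  vsft_constraint : forall u, U u -> L^T *m Oxx u = (Oxx u)^T *m L }.

(* Action of the transformation on a column family eta with potential
   Oe = Omega(eta, xi^* ), on a row family theta with potential
   Ot = Omega(xi, theta), and on a potential O = Omega(eta, theta). *)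
Definition transform_col {m n : nat} (xi : 'I_N -> 'cV[R]_N -> 'cV[R]_m)
    (Oxx : 'cV[R]_N -> 'M[R]_m) (eta : 'I_N -> 'cV[R]_N -> 'cV[R]_n)
    (Oe : 'cV[R]_N -> 'M[R]_(n, m)) (i : 'I_N) (u : 'cV[R]_N) : 'cV[R]_n :=
  eta i u - Oe u *m invmx (Oxx u) *m xi i u.

Definition transform_row {m n : nat} (xis : 'I_N -> 'cV[R]_N -> 'rV[R]_m)
    (Oxx : 'cV[R]_N -> 'M[R]_m) (theta : 'I_N -> 'cV[R]_N -> 'rV[R]_n)
    (Ot : 'cV[R]_N -> 'M[R]_(m, n)) (i : 'I_N) (u : 'cV[R]_N) : 'rV[R]_n :=
  theta i u - xis i u *m invmx (Oxx u) *m Ot u.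

Definition transform_pot {m n p : nat} (Oxx : 'cV[R]_N -> 'M[R]_m)
    (O : 'cV[R]_N -> 'M[R]_(n, p)) (Oe : 'cV[R]_N -> 'M[R]_(n, m))
    (Ot : 'cV[R]_N -> 'M[R]_(m, p)) (u : 'cV[R]_N) : 'M[R]_(n, p) :=
  O u - Oe u *m invmx (Oxx u) *m Ot u.

Definition vsft {D m : nat} (S : net D)
    (xi : 'I_N -> 'cV[R]_N -> 'cV[R]_m) (L : 'M[R]_m)
    (Oxx : 'cV[R]_N -> 'M[R]_m) (OX : 'cV[R]_N -> 'M[R]_(D, m))
    (OH : 'cV[R]_N -> 'cV[R]_m) : net D := Net
  (fun i j u => rotation S i j u - (star xi L j u *m invmx (Oxx u) *m xi i u) 0 0)
  (transform_col xi Oxx (tangent S) OX)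
  (fun i u => lame S i u - (star xi L i u *m invmx (Oxx u) *m OH u) 0 0)
  (transform_pot Oxx (position S) OX OH).

End Transformation.

Arguments net : clear implicits.

(* Main.v *)
Require Import Defs.
From HB Require Import structures.
From mathcomp Require Import all_boot all_order all_algebra.
From mathcomp Require Import all_classical all_reals all_analysis.
From mathcomp Require Import ring.

Set Implicit Arguments.
Unset Strict Implicit.
Unset Printing Implicit Defensive.
Import Order.TTheory GRing.Theory Num.Theory.
Import numFieldNormedType.Exports.
Local Open Scope classical_set_scope.
Local Open Scope ring_scope.

(** The action of a fundamental transformation on columns, rows and potentials
is a Schur-complement operation [O - Oe Oxx^-1 Ot], and differentiating it with
[d(Oxx^-1) = - Oxx^-1 (xi_i xi_i^* ) Oxx^-1] shows that the transformed families
solve the linear systems of the transformed rotation coefficients. The constraint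
[L^T Oxx = Oxx^T L] makes [L Oxx^-1] symmetric, which gives the symmetry of the
new coefficients and [xi'^* = xi'^T L]. The composition formula is then
Gaussian elimination in block form: eliminating [V2] first and [V1] next inverts
the block matrix [Om], the pivot of the second step being the Schur complement
[O11 - O12 O22^-1 O21]. *)

(** * Stability of smooth maps on an open set under algebraic operations *)

Section SmoothFunctions.
Context {R : realType} {N : nat}.
Variable U : set 'cV[R]_N.
Hypothesis openU : open U.

(** Openness of [U] makes agreement on [U] an agreement of germs, which is all that limits and
    derivatives see. *)
Lemma near_eq_on (T : Type) (f g : 'cV[R]_N -> T) (u : 'cV[R]_N) :
  (forall x, U x -> f x = g x) -> U u -> \forall x \near u, f x = g x.
Proof.
by move=> fg Uu; apply: filterS fg _; exact: open_nbhs_nbhs.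
Qed.

Lemma eq_on_pd (W : normedModType R) (f g : 'cV[R]_N -> W) i u :
  (forall x, U x -> f x = g x) -> U u -> pd i f u = pd i g u.
Proof. by move=> fg Uu; apply: near_eq_derive; exact: near_eq_on. Qed.

(** Formulas for derivatives hold only on [U], while [Ck] speaks of total functions; this lets such
    a formula replace [pd i f] in the inductions below. *)
Lemma Ck_eq_on (W : normedModType R) k (f g : 'cV[R]_N -> W) :
  (forall u, U u -> f u = g u) -> Ck U k f -> Ck U k g.
Proof.
have cont (h h' : 'cV[R]_N -> W) : (forall u, U u -> h u = h' u) ->
    (forall u, U u -> {for u, continuous h}) ->
    forall u, U u -> {for u, continuous h'}.
  move=> hh' ch u Uu; rewrite /prop_for /continuous_at -(hh' u Uu).
  by apply: cvg_trans (ch u Uu); exact: near_eq_cvg (near_eq_on hh' Uu).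
elim: k f g => [|k IHk] f g fg [cf df]; have cg := cont _ _ fg cf; split=> // i.
have [di Ci] := df i; split=> [u Uu|].
  by apply: near_eq_derivable (di u Uu); exact: near_eq_on.
by apply: IHk Ci => u Uu; exact: eq_on_pd.
Qed.

Lemma CkW (W : normedModType R) k (f : 'cV[R]_N -> W) :
  Ck U k.+1 f -> Ck U k f.
Proof.
elim: k f => [|k IHk] f [cf df]; split=> // i.
by have [di Ci] := df i; split=> //; exact: IHk.
Qed.

Lemma Ck_cst (W : normedModType R) k (c : W) : Ck U k (fun=> c).
Proof.
have cc (d : W) u : U u -> {for u, continuous (fun=> d : W)}.
  by move=> _; exact: cst_continuous.
elim: k c => [|k IHk] c; have cf := cc c; split=> // i.
split=> [u _|]; first exact: derivable_cst.
by apply: Ck_eq_on (IHk 0) => u _; rewrite /pd derive_cst.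
Qed.

Lemma CkD (W : normedModType R) k (f g : 'cV[R]_N -> W) :
  Ck U k f -> Ck U k g -> Ck U k (fun u => f u + g u).
Proof.
elim: k f g => [|k IHk] f g [cf df] [cg dg];
  (have cfg u : U u -> {for u, continuous (fun u => f u + g u)}
    by move=> Uu; exact: (cvgD (cf _ Uu) (cg _ Uu)));
  split=> // i.
have [[dfi Cf] [dgi Cg]] := (df i, dg i); split=> [u Uu|].
  by apply: derivableD; [exact: dfi|exact: dgi].
apply: Ck_eq_on (IHk _ _ Cf Cg) => u Uu.
by rewrite /pd -deriveD; [|exact: dfi|exact: dgi].
Qed.

Lemma CkM k (f g : 'cV[R]_N -> R) :
  Ck U k f -> Ck U k g -> Ck U k (fun u => f u * g u).
Proof.
elim: k f g => [|k IHk] f g Cf Cg; have [[cf df] [cg dg]] := (Cf, Cg);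
  (have cfg u : U u -> {for u, continuous (fun u => f u * g u)}
    by move=> Uu; exact: (cvgM (cf _ Uu) (cg _ Uu)));
  split=> // i.
have [[dfi Cfi] [dgi Cgi]] := (df i, dg i); split=> [u Uu|].
  by apply: derivableM; [exact: dfi|exact: dgi].
(* Leibniz rule: the undifferentiated factors are lowered to order [k] to match the differentiated
   ones. *)
apply: Ck_eq_on (CkD (IHk _ _ (CkW Cf) Cgi) (IHk _ _ (CkW Cg) Cfi)) => u Uu.
by symmetry; apply: deriveM; [exact: dfi|exact: dgi].
Qed.

Lemma CkV k (f : 'cV[R]_N -> R) : (forall u, U u -> f u != 0) ->
  Ck U k f -> Ck U k (fun u => (f u)^-1).
Proof.
move=> f0; elim: k => [|k IHk] Cf; have [cf df] := Cf;
  (have cV u : U u -> {for u, continuous (fun u => (f u)^-1)}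
    by move=> Uu; exact: (cvgV (f0 _ Uu) (cf _ Uu)));
  split=> // i.
have [dfi Cfi] := df i; split=> [u Uu|].
  by apply: derivableV; [exact: f0|exact: dfi].
have CV := IHk (CkW Cf).
(* The derivative of [f^-1] is [- f^-2] times that of [f], a product of maps already known to be of
   order [k]. *)
have Cm := CkM (CkM (CkM CV CV) (Ck_cst k (-1 : R))) Cfi.
apply: Ck_eq_on Cm => u Uu; symmetry; rewrite mulrN1 -invfM -expr2.
by apply: deriveV; [exact: f0|exact: dfi].
Qed.

Lemma Ck_mxP k m n (F : 'cV[R]_N -> 'M[R]_(m, n)) :
  Ck U k F <-> forall i j, Ck U k (fun u => F u i j).
Proof.
have cont (G : 'cV[R]_N -> 'M[R]_(m, n)) u :
    {for u, continuous G} <-> forall i j, {for u, continuous (fun x => G x i j)}.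
  split=> [cG i j|cG].
    exact: (continuous_comp cG (@coord_continuous _ _ _ i j _)).
  (* The matrix norm is the maximum over the entries, so finitely many entrywise estimates hold on a
     common neighbourhood. *)
  apply/(@cvgrPdist_le _ _ _ _ (nbhs_filter u)) => /= e e0; near=> x.
  rewrite /Num.Def.normr/= mx_normrE (bigmax_le _ (ltW e0))//= => i _.
  rewrite !mxE; move: i; near: x; apply: filter_forall => /= i.
  exact: (@cvgrPdist_le _ _ _ _ (nbhs_filter u) _ _).1 (cG i.1 i.2) _ e0.
elim: k F => [|k IHk] F; split.
- by case=> cF _ i j; split=> // u Uu; apply: (cont _ _).1 (cF u Uu) i j.
- by move=> CF; split=> // u Uu; apply/cont => i j; apply: (CF i j).1.
- move=> [cF dF] i j; split=> [u Uu|l]; first exact: (cont _ _).1 (cF u Uu) i j.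
  have [dl Cl] := dF l; split=> [u Uu|].
    exact: (derivable_mxP _ _ _).1 (dl u Uu) i j.
  apply: Ck_eq_on ((IHk _).1 Cl i j) => u Uu.
  by rewrite /pd derive_mx ?mxE//; exact: dl.
- move=> CF; split=> [u Uu|l]; first by apply/cont => i j; apply: (CF i j).1.
  have dF u : U u -> derivable F u (delta_mx l 0).
    by move=> Uu; apply/derivable_mxP => i j; apply: ((CF i j).2 l).1.
  split=> //; apply/IHk => i j.
  apply: Ck_eq_on ((CF i j).2 l).2 => u Uu.
  by rewrite /pd derive_mx ?mxE//; exact: dF.
Unshelve. all: by end_near. Qed.

Lemma smooth_mxP m n (F : 'cV[R]_N -> 'M[R]_(m, n)) :
  smooth U F <-> forall i j, smooth U (fun u => F u i j).
Proof.
split=> [sF i j k|sF k]; first exact: (Ck_mxP k F).1 (sF k) i j.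
by apply/Ck_mxP => i j; exact: sF.
Qed.

Lemma smooth_cst (W : normedModType R) (c : W) : smooth U (fun=> c).
Proof. by move=> k; exact: Ck_cst. Qed.

Lemma smoothD (W : normedModType R) (f g : 'cV[R]_N -> W) :
  smooth U f -> smooth U g -> smooth U (fun u => f u + g u).
Proof. by move=> sf sg k; exact: CkD. Qed.

Lemma smoothM (f g : 'cV[R]_N -> R) :
  smooth U f -> smooth U g -> smooth U (fun u => f u * g u).
Proof. by move=> sf sg k; exact: CkM. Qed.

Lemma smoothV (f : 'cV[R]_N -> R) : (forall u, U u -> f u != 0) ->
  smooth U f -> smooth U (fun u => (f u)^-1).
Proof. by move=> f0 sf k; exact: CkV. Qed.

Lemma smooth_eq_on (W : normedModType R) (f g : 'cV[R]_N -> W) :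
  (forall u, U u -> f u = g u) -> smooth U f -> smooth U g.
Proof. by move=> fg sf k; apply: Ck_eq_on fg (sf k). Qed.

Lemma smooth_sum (W : normedModType R) (I : Type) (r : seq I) (P : pred I)
    (f : I -> 'cV[R]_N -> W) :
  (forall i, smooth U (f i)) -> smooth U (fun u => \sum_(i <- r | P i) f i u).
Proof.
move=> sf; elim: r => [|i r IHr].
  by apply: smooth_eq_on (smooth_cst 0) => u _; rewrite big_nil.
apply: (@smooth_eq_on _ (fun u => if P i then f i u + \sum_(j <- r | P j) f j u
  else \sum_(j <- r | P j) f j u)) => [u _|]; first by rewrite big_cons.
by case: (P i) => //; exact: smoothD.
Qed.

Lemma smooth_prod (I : Type) (r : seq I) (P : pred I)
    (f : I -> 'cV[R]_N -> R) :
  (forall i, smooth U (f i)) -> smooth U (fun u => \prod_(i <- r | P i) f i u).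
Proof.
move=> sf; elim: r => [|i r IHr].
  by apply: smooth_eq_on (smooth_cst (1 : R)) => u _; rewrite big_nil.
apply: (@smooth_eq_on _ (fun u => if P i then f i u * \prod_(j <- r | P j) f j u
  else \prod_(j <- r | P j) f j u)) => [u _|]; first by rewrite big_cons.
by case: (P i) => //; exact: smoothM.
Qed.

Lemma smooth_entry m n (F : 'cV[R]_N -> 'M[R]_(m, n)) i j :
  smooth U F -> smooth U (fun u => F u i j).
Proof. by move/smooth_mxP; exact. Qed.

Lemma smooth_mulmx m n p (F : 'cV[R]_N -> 'M[R]_(m, n))
    (G : 'cV[R]_N -> 'M[R]_(n, p)) :
  smooth U F -> smooth U G -> smooth U (fun u => F u *m G u).
Proof.
move=> sF sG; apply/smooth_mxP => i j.
have s k : smooth U (fun u => F u i k * G u k j).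
  by apply: smoothM; exact: smooth_entry.
by apply: smooth_eq_on (smooth_sum _ _ s) => u _; rewrite mxE.
Qed.

Lemma smoothN m n (F : 'cV[R]_N -> 'M[R]_(m, n)) :
  smooth U F -> smooth U (fun u => - F u).
Proof.
move=> sF; apply: smooth_eq_on (smooth_mulmx sF (smooth_cst ((-1)%:M : 'M[R]_n))) => u _.
by rewrite mul_mx_scalar scaleN1r.
Qed.

Lemma smoothB m n (F G : 'cV[R]_N -> 'M[R]_(m, n)) :
  smooth U F -> smooth U G -> smooth U (fun u => F u - G u).
Proof. by move=> sF sG; apply: smoothD sF (smoothN sG). Qed.

Lemma smooth_trmx m n (F : 'cV[R]_N -> 'M[R]_(m, n)) :
  smooth U F -> smooth U (fun u => (F u)^T).
Proof.
move=> sF; apply/smooth_mxP => i j.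
by apply: smooth_eq_on (smooth_entry j i sF) => u _; rewrite mxE.
Qed.

Lemma smooth_det n (F : 'cV[R]_N -> 'M[R]_n) :
  smooth U F -> smooth U (fun u => \det (F u)).
Proof.
move=> sF; apply: smooth_sum => s; apply: smoothM; first exact: smooth_cst.
by apply: smooth_prod => i; exact: smooth_entry.
Qed.

(** Cramer's rule: each entry is a cofactor, polynomial in the entries of [F], over a determinant
    that does not vanish on [U]. *)
Lemma smooth_invmx n (F : 'cV[R]_N -> 'M[R]_n) :
  (forall u, U u -> F u \in unitmx) -> smooth U F ->
  smooth U (fun u => invmx (F u)).
Proof.
move=> uF sF; apply/smooth_mxP => i j.
(* The adjugate is the transposed cofactor matrix, hence row [j] and column [i] are deleted for
   entry [(i, j)]. *)
pose f u := (\det (F u))^-1 * ((-1) ^+ (j + i) * \det (row' j (col' i (F u)))).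
apply: (@smooth_eq_on _ f) => [u Uu|].
  by rewrite /invmx uF// !mxE.
apply: smoothM.
  by apply: smoothV (smooth_det sF) => u /uF; rewrite unitmxE unitfE.
apply: smoothM; first exact: smooth_cst.
apply: smooth_det; apply/smooth_mxP => k l.
by apply: smooth_eq_on (smooth_entry (lift j k) (lift i l) sF) => u _;
  rewrite !mxE.
Qed.

Lemma smooth_is_derive (W : normedModType R) (f : 'cV[R]_N -> W) i u :
  smooth U f -> U u -> is_derive u (delta_mx i 0) f (pd i f u).
Proof. by move=> sf Uu; apply/derivableP; apply: ((sf 1).2 i).1. Qed.

End SmoothFunctions.

(** * Directional derivatives of matrix products, transposes and inverses *)

Section MatrixDerivatives.
Context {R : realType} {V : normedModType R}.
Implicit Types u v : V.

Lemma is_derive_mxP m n (F : V -> 'M[R]_(m, n)) u v dF :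
  is_derive u v F dF <-> forall i j, is_derive u v (fun x => F x i j) (dF i j).
Proof.
split=> [[dFu <-] i j|dF'].
  rewrite derive_mx// mxE; apply/derivableP.
  exact: (derivable_mxP _ _ _).1 dFu i j.
have dFu : derivable F u v.
  by apply/derivable_mxP => i j; have [] := dF' i j.
split=> //; apply/matrixP => i j; rewrite derive_mx// mxE.
by have [_ <-] := dF' i j.
Qed.

Lemma is_derive_mulmx m n p (F : V -> 'M[R]_(m, n)) (G : V -> 'M[R]_(n, p))
    u v dF dG :
  is_derive u v F dF -> is_derive u v G dG ->
  is_derive u v (fun x => F x *m G x) (dF *m G u + F u *m dG).
Proof.
move=> /is_derive_mxP dFu /is_derive_mxP dGu; apply/is_derive_mxP => i j.
have dFG k := is_deriveM (dFu i k) (dGu k j).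
have := is_derive_sum dFG.
rewrite (_ : \sum_k _ = fun x => (F x *m G x) i j); last first.
  by apply/funext => x; rewrite mxE fct_sumE.
move=> d; apply: is_derive_eq d _.
rewrite !mxE -big_split/=; apply: eq_bigr => k _.
by rewrite addrC [X in _ + X]mulrC; congr (_ + _); rewrite mulrC.
Qed.

Lemma is_derive_trmx m n (F : V -> 'M[R]_(m, n)) u v dF :
  is_derive u v F dF -> is_derive u v (fun x => (F x)^T) dF^T.
Proof.
move=> /is_derive_mxP dFu; apply/is_derive_mxP => i j; rewrite mxE.
by rewrite (_ : (fun x => _) = (fun x => F x j i))//; apply/funext => x;
  rewrite mxE.
Qed.

(** Differentiate [invmx F *m F = 1] and solve for the derivative of the inverse. The identity has
    to hold near [u], hence the neighbourhood in the first hypothesis. *)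
Lemma is_derive_invmx n (F : V -> 'M[R]_n) u v dF :
  (\forall x \near u, F x \in unitmx) ->
  derivable (fun x => invmx (F x)) u v -> is_derive u v F dF ->
  is_derive u v (fun x => invmx (F x)) (- (invmx (F u) *m dF *m invmx (F u))).
Proof.
move=> uF /derivableP dV dFu; apply: is_derive_eq (dV) _.
have Fu := nbhs_singleton uF.
have [_ d1] := is_derive_mulmx dV dFu.
have : 'D_v (fun x => invmx (F x) *m F x) u = 0.
  rewrite -(derive_cst (1%:M : 'M[R]_n) u v); apply: near_eq_derive.
  by apply: filterS uF => x Fx; rewrite mulVmx.
rewrite d1 => /(congr1 (mulmx^~ (invmx (F u)))).
by rewrite mulmxDl mul0mx mulmxK// => /eqP; rewrite addr_eq0 => /eqP ->.
Qed.

End MatrixDerivatives.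

(** * Schur complements and block elimination *)

Section BlockInverse.
Context {F : fieldType} {n1 n2 : nat}.
Variables (A11 : 'M[F]_(n1, n1)) (A12 : 'M[F]_(n1, n2))
  (A21 : 'M[F]_(n2, n1)) (A22 : 'M[F]_(n2, n2)).
Let A := block_mx A11 A12 A21 A22.
Let B := A11 - A12 *m invmx A22 *m A21.
Hypothesis uA22 : A22 \in unitmx.

Lemma block_mx_schur :
  A = block_mx B A12 0 A22 *m block_mx 1%:M 0 (invmx A22 *m A21) 1%:M.
Proof.
by rewrite mulmx_block !mulmx1 mulmx0 mul0mx !add0r mulKVmx// mulmxA subrK.
Qed.

(** The block triangular factor of [A] is invertible and its determinant is [\det B * \det A22]. *)
Lemma schur_unitmx : A \in unitmx -> B \in unitmx.
Proof.
rewrite block_mx_schur unitmx_mul => /andP[+ _].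
by rewrite !unitmxE det_ublock unitrM => /andP[].
Qed.

(** This is the composition formula in pure algebra: the first summand is the correction made by
    step 1, the second the correction made by step 2 on data already transformed. Solving one linear
    system avoids writing out the inverse of [A]. *)
Lemma mul_row_invmx_block_col p q (r1 : 'M[F]_(p, n1)) (r2 : 'M[F]_(p, n2))
    (c1 : 'M[F]_(n1, q)) (c2 : 'M[F]_(n2, q)) : A \in unitmx ->
  row_mx r1 r2 *m invmx A *m col_mx c1 c2 =
  r2 *m invmx A22 *m c2 +
  (r1 - r2 *m invmx A22 *m A21) *m invmx B *m (c1 - A12 *m invmx A22 *m c2).
Proof.
move=> uA; have uB := schur_unitmx uA.
(* Back substitution for [A y = c]: [y1] comes from the Schur complement, [y2] from the second block
   row. *)
set y1 := invmx B *m (c1 - A12 *m invmx A22 *m c2).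
set y2 := invmx A22 *m (c2 - A21 *m y1).
have Ay : A *m col_mx y1 y2 = col_mx c1 c2.
  have c1E : c1 = B *m y1 + A12 *m invmx A22 *m c2.
    by rewrite /y1 mulKVmx// subrK.
  rewrite mul_block_col; congr col_mx; last first.
    by rewrite /y2 mulKVmx// addrC subrK.
  rewrite [RHS]c1E /B /y2 mulmxBl mulmxBr mulmxBr !mulmxA -!addrA.
  by congr (_ + _); rewrite addrC.
rewrite -mulmxA -Ay mulKmx// mul_row_col -[_ *m invmx B *m _]mulmxA -/y1.
by rewrite /y2 mulmxBl !mulmxBr !mulmxA addrCA.
Qed.

End BlockInverse.

(** * The transformation of linear systems and potentials for arbitrary covectors *)

Section FundamentalTransformation.
Context {R : realType} {N : nat}.
Variable U : set 'cV[R]_N.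
Hypothesis openU : open U.
Variable beta : 'I_N -> 'I_N -> 'cV[R]_N -> R.

Lemma potential_is_derive m n (eta : 'I_N -> 'cV[R]_N -> 'cV[R]_m)
    (theta : 'I_N -> 'cV[R]_N -> 'rV[R]_n) Om i u :
  potential U eta theta Om -> U u ->
  is_derive u (delta_mx i 0) Om (eta i u *m theta i u).
Proof. by case=> sO dO Uu; rewrite -dO//; exact: smooth_is_derive sO Uu. Qed.

Lemma direct_is_derive (W : normedModType R) (eta : 'I_N -> 'cV[R]_N -> W)
    i j u : direct_system U beta eta -> i != j -> U u ->
  is_derive u (delta_mx i 0) (eta j) (beta j i u *: eta i u).
Proof. by case=> s d ij Uu; rewrite -d//; exact: smooth_is_derive (s j) Uu. Qed.

Lemma adjoint_is_derive (W : normedModType R) (theta : 'I_N -> 'cV[R]_N -> W)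
    i j u : adjoint_system U beta theta -> i != j -> U u ->
  is_derive u (delta_mx i 0) (theta j) (beta i j u *: theta i u).
Proof. by case=> s d ij Uu; rewrite -d//; exact: smooth_is_derive (s j) Uu. Qed.

Lemma is_derive_pd (W : normedModType R) (f : 'cV[R]_N -> W) i u df :
  is_derive u (delta_mx i 0) f df -> pd i f u = df.
Proof. by case. Qed.

Lemma eq_potential m n (eta : 'I_N -> 'cV[R]_N -> 'cV[R]_m)
    (theta theta' : 'I_N -> 'cV[R]_N -> 'rV[R]_n) Om :
  (forall i u, U u -> theta i u = theta' i u) ->
  potential U eta theta Om -> potential U eta theta' Om.
Proof. by move=> tt' [s d]; split=> // i u Uu; rewrite d// tt'. Qed.

(** Transposing the direct system leaves the coefficient [beta j i]; symmetry turns it into the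
    [beta i j] of the adjoint system. *)
Lemma adjoint_star m (xi : 'I_N -> 'cV[R]_N -> 'cV[R]_m) (L : 'M[R]_m) :
  symmetric_coeffs U beta -> direct_system U beta xi ->
  adjoint_system U beta (star xi L).
Proof.
move=> sym dxi; split=> [i|i j ij u Uu].
  apply: smooth_mulmx => //; last exact: smooth_cst.
  by apply: smooth_trmx => //; exact: dxi.1.
have d := is_derive_mulmx (is_derive_trmx (direct_is_derive dxi ij Uu))
  (is_derive_cst L u (delta_mx i 0)).
apply: etrans (is_derive_pd d) _.
by rewrite mulmx0 addr0 linearZ /= -scalemxAl sym// eq_sym.
Qed.

Variable m : nat.
Variables (xi : 'I_N -> 'cV[R]_N -> 'cV[R]_m)
  (xis : 'I_N -> 'cV[R]_N -> 'rV[R]_m) (Oxx : 'cV[R]_N -> 'M[R]_m).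
Hypothesis direct_xi : direct_system U beta xi.
Hypothesis adjoint_xis : adjoint_system U beta xis.
Hypothesis pot_Oxx : potential U xi xis Oxx.
Hypothesis unit_Oxx : forall u, U u -> Oxx u \in unitmx.

(** The covectors [xis] are not tied to [xi] here; taking [xis := star xi L] gives the rotation
    coefficients of [vsft]. *)
Definition transform_rot (i j : 'I_N) (u : 'cV[R]_N) : R :=
  beta i j u - (xis j u *m invmx (Oxx u) *m xi i u) 0 0.

Let smooth_inv : smooth U (fun u => invmx (Oxx u)).
Proof. by apply: smooth_invmx => //; exact: pot_Oxx.1. Qed.

Let is_derive_inv i u : U u ->
  is_derive u (delta_mx i 0) (fun x => invmx (Oxx x))
    (- (invmx (Oxx u) *m (xi i u *m xis i u) *m invmx (Oxx u))).
Proof.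
move=> Uu; apply: is_derive_invmx.
- by apply: filterS unit_Oxx _; exact: open_nbhs_nbhs.
- by have [] := smooth_is_derive i smooth_inv Uu.
- exact: potential_is_derive.
Qed.

(** With [s] the scalar [xis_i Oxx^-1 xi_j], the terms of the derivative factor as
    [(beta_ji - s) (eta_i - Oe Oxx^-1 xi_i)]. *)
Lemma direct_transform_col n (eta : 'I_N -> 'cV[R]_N -> 'cV[R]_n) Oe :
  direct_system U beta eta -> potential U eta xis Oe ->
  direct_system U transform_rot (transform_col xi Oxx eta Oe).
Proof.
move=> deta pOe; split=> [i|i j ij u Uu].
  apply: smoothB => //; first exact: deta.1.
  apply: smooth_mulmx => //; last exact: direct_xi.1.
  by apply: smooth_mulmx => //; exact: pOe.1.
apply: etrans (is_derive_pd (is_deriveB (direct_is_derive deta ij Uu)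
  (is_derive_mulmx (is_derive_mulmx (potential_is_derive i pOe Uu)
    (is_derive_inv i Uu)) (direct_is_derive direct_xi ij Uu)))) _.
rewrite /transform_rot /transform_col.
(* A 1 by 1 product is a scalar matrix, so it can be pulled out of the surrounding products. *)
set s := (_ 0 0); have sE : xis i u *m (invmx (Oxx u) *m xi j u) = s%:M.
  by rewrite mulmxA; exact: mx11_scalar.
rewrite mulmxDl mulmxN mulNmx -!mulmxA sE !mul_mx_scalar -!scalemxAr.
move: (Oe u *m _) => w.
by apply/matrixP => k l; rewrite !mxE; ring.
Qed.

Lemma adjoint_transform_row n (theta : 'I_N -> 'cV[R]_N -> 'rV[R]_n) Ot :
  adjoint_system U beta theta -> potential U xi theta Ot ->
  adjoint_system U transform_rot (transform_row xis Oxx theta Ot).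
Proof.
move=> dtheta pOt; split=> [i|i j ij u Uu].
  apply: smoothB => //; first exact: dtheta.1.
  apply: smooth_mulmx => //; last exact: pOt.1.
  by apply: smooth_mulmx => //; exact: adjoint_xis.1.
apply: etrans (is_derive_pd (is_deriveB (adjoint_is_derive dtheta ij Uu)
  (is_derive_mulmx (is_derive_mulmx (adjoint_is_derive adjoint_xis ij Uu)
    (is_derive_inv i Uu)) (potential_is_derive i pOt Uu)))) _.
rewrite /transform_rot /transform_row.
set s := (_ 0 0); have sE : xis j u *m invmx (Oxx u) *m xi i u = s%:M.
  exact: mx11_scalar.
rewrite !mulmxDl mulmxN mulNmx !mulmxA sE -!mulmxA !mul_scalar_mx.
rewrite -!scalemxAl; move: (xis i u *m _) => w.
by apply/matrixP => k l; rewrite !mxE; ring.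
Qed.

(** The four terms of the derivative are the expansion of [(eta_i - Oe Oxx^-1 xi_i) (theta_i - xis_i
    Oxx^-1 Ot)]. The new position and the potentials of step 2 are all instances. *)
Lemma potential_transform_pot n p (eta : 'I_N -> 'cV[R]_N -> 'cV[R]_n)
    (theta : 'I_N -> 'cV[R]_N -> 'rV[R]_p) O Oe Ot :
  potential U eta theta O -> potential U eta xis Oe -> potential U xi theta Ot ->
  potential U (transform_col xi Oxx eta Oe) (transform_row xis Oxx theta Ot)
    (transform_pot Oxx O Oe Ot).
Proof.
move=> pO pOe pOt; split=> [|i u Uu].
  apply: smoothB => //; first exact: pO.1.
  apply: smooth_mulmx => //; last exact: pOt.1.
  by apply: smooth_mulmx => //; exact: pOe.1.
apply: etrans (is_derive_pd (is_deriveB (potential_is_derive i pO Uu)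
  (is_derive_mulmx (is_derive_mulmx (potential_is_derive i pOe Uu)
    (is_derive_inv i Uu)) (potential_is_derive i pOt Uu)))) _.
rewrite /transform_col /transform_row.
rewrite !mulmxBl !mulmxBr mulmxDl mulmxN mulNmx !mulmxA.
by rewrite !opprD !opprK !addrA addrAC.
Qed.

Lemma smooth_transform_rot i j : smooth U (beta i j) ->
  smooth U (transform_rot i j).
Proof.
move=> sb; pose c u : 'M[R]_1 := xis j u *m invmx (Oxx u) *m xi i u.
have sc : smooth U (fun u => (- c u) 0 0).
  apply: smooth_entry => //; apply: smoothN => //; apply: smooth_mulmx => //.
    by apply: smooth_mulmx => //; exact: adjoint_xis.1.
  exact: direct_xi.1.
by apply: smooth_eq_on (smoothD openU sb sc) => // u _; rewrite mxE.
Qed.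

(** With [s = xis_j Oxx^-1 xi_k] and [t = xis_k Oxx^-1 xi_i], the derivative along [k] is [beta_ik
    beta_kj - beta_kj t + t s - beta_ik s], which is [(beta_ik - t) (beta_kj - s)]. *)
Lemma darboux_transform_rot :
  (forall i j, i != j -> smooth U (beta i j)) -> darboux U beta ->
  darboux U transform_rot.
Proof.
move=> sb db i j k ij jk ik u Uu.
have dxis : is_derive u (delta_mx k 0) (xis j) (beta k j u *: xis k u).
  by apply: adjoint_is_derive; rewrite // eq_sym.
have dxi : is_derive u (delta_mx k 0) (xi i) (beta i k u *: xi k u).
  by apply: direct_is_derive; rewrite // eq_sym.
have dbeta := smooth_is_derive k (sb _ _ ij) Uu.
have dc := is_derive_mulmx (is_derive_mulmx dxis (is_derive_inv k Uu)) dxi.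
apply: etrans (is_derive_pd (is_deriveB dbeta ((is_derive_mxP _ _ _ _).1 dc 0 0))) _.
rewrite db// /transform_rot.
set s := ((xis j u *m _ *m xi k u) 0 0).
have sE : xis j u *m invmx (Oxx u) *m xi k u = s%:M by exact: mx11_scalar.
rewrite !mulmxDl mulmxN mulNmx !mulmxA -scalemxAr sE -!mulmxA !mul_scalar_mx.
rewrite -!scalemxAl -[in LHS]/s; move: (xis k u *m _) => w.
by rewrite !mxE eqxx mulr1n; ring.
Qed.

End FundamentalTransformation.

(** * The symmetric reduction, and nets under one transformation *)

Section SymmetricTransformation.
Context {R : realType} {N : nat}.
Variable U : set 'cV[R]_N.
Hypothesis openU : open U.

(** Nets carry scalar Lamé coefficients, whereas the transformation lemmas treat row families; this
    passes between the two. *)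
Lemma adjoint_as_row (beta : 'I_N -> 'I_N -> 'cV[R]_N -> R) H :
  adjoint_system U beta (as_row H) <-> adjoint_system U beta H.
Proof.
have HE i : H i = (fun u => as_row H i u 0 0).
  by apply/funext => u; rewrite mxE eqxx mulr1n.
split=> [dH|dH].
  split=> [i|i j ij u Uu].
    by rewrite HE; apply: smooth_entry => //; exact: dH.1.
  rewrite (HE j); apply: is_derive_pd.
  have := (is_derive_mxP _ _ _ _).1 (adjoint_is_derive dH ij Uu) 0 0.
  by rewrite !mxE eqxx mulr1n.
split=> [i|i j ij u Uu].
  by apply/smooth_mxP => // k l; rewrite !ord1 -HE; exact: dH.1.
apply: is_derive_pd; apply/is_derive_mxP => k l; rewrite !ord1 -HE.
have := adjoint_is_derive dH ij Uu.
by rewrite !mxE eqxx mulr1n.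
Qed.

(** Multiply the constraint by the inverse of [O^T] on the left and by that of [O] on the right. *)
Lemma trmx_mul_invmx m (L O : 'M[R]_m) : O \in unitmx ->
  L^T *m O = O^T *m L -> (invmx O)^T *m L^T = L *m invmx O.
Proof.
move=> uO LO; have uOT : O^T \in unitmx by rewrite unitmx_tr.
by rewrite trmx_inv; apply: (canLR (mulKmx uOT)); rewrite mulmxA -LO mulmxK.
Qed.

(** The correction is the bilinear form of the symmetric matrix [L Oxx^-1] evaluated at [xi_j] and
    [xi_i]. *)
Lemma symmetric_transform_rot beta m (xi : 'I_N -> 'cV[R]_N -> 'cV[R]_m)
    (L : 'M[R]_m) Oxx :
  symmetric_coeffs U beta -> (forall u, U u -> Oxx u \in unitmx) ->
  (forall u, U u -> L^T *m Oxx u = (Oxx u)^T *m L) ->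
  symmetric_coeffs U (transform_rot beta xi (star xi L) Oxx).
Proof.
move=> sb uO LO i j ij u Uu; rewrite /transform_rot sb//; congr (_ - _).
have tr00 (M : 'M[R]_1) : M 0 0 = M^T 0 0 by rewrite mxE.
rewrite [RHS]tr00 /star.
rewrite !trmx_mul trmxK -!mulmxA [(invmx _)^T *m _]mulmxA.
by rewrite trmx_mul_invmx ?uO ?LO// !mulmxA.
Qed.

Lemma as_row_lame_vsft D m (S : net R N D) (xi : 'I_N -> 'cV[R]_N -> 'cV[R]_m)
    (L : 'M[R]_m) Oxx OX OH : as_row (lame (vsft S xi L Oxx OX OH)) =
  transform_row (star xi L) Oxx (as_row (lame S)) OH.
Proof.
apply/funext => i; apply/funext => u; rewrite /as_row /transform_row /=.
by rewrite raddfB /= -mx11_scalar.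
Qed.

Lemma is_net_vsft D m (S : net R N D) (xi : 'I_N -> 'cV[R]_N -> 'cV[R]_m)
    (L : 'M[R]_m) Oxx OX OH :
  is_net U S -> vsft_requirements U S xi L Oxx OX OH ->
  is_net U (vsft S xi L Oxx OX OH).
Proof.
move=> [sb db dX dH px] [sym dxi pO pOX pOH uO LO].
have dxis := adjoint_star openU L sym dxi.
split.
- by move=> i j ij; apply: smooth_transform_rot => //; exact: sb.
- exact: darboux_transform_rot.
- exact: direct_transform_col.
- apply/adjoint_as_row; rewrite as_row_lame_vsft.
  by apply: adjoint_transform_row => //; apply/adjoint_as_row.
- by rewrite as_row_lame_vsft; exact: potential_transform_pot.
Qed.

End SymmetricTransformation.

(** * Composition of two symmetric transformations *)

Theorem mainTheorem3 (R : realType) (N D n1 n2 : nat)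
    (U : set 'cV[R]_N) (S : net R N D)
    (xi1 : 'I_N -> 'cV[R]_N -> 'cV[R]_n1) (L1 : 'M[R]_n1)
    (xi2 : 'I_N -> 'cV[R]_N -> 'cV[R]_n2) (L2 : 'M[R]_n2)
    (O11 : 'cV[R]_N -> 'M[R]_(n1, n1)) (O12 : 'cV[R]_N -> 'M[R]_(n1, n2))
    (O21 : 'cV[R]_N -> 'M[R]_(n2, n1)) (O22 : 'cV[R]_N -> 'M[R]_(n2, n2))
    (OX1 : 'cV[R]_N -> 'M[R]_(D, n1)) (OX2 : 'cV[R]_N -> 'M[R]_(D, n2))
    (OH1 : 'cV[R]_N -> 'cV[R]_n1) (OH2 : 'cV[R]_N -> 'cV[R]_n2) :
  let L : 'M[R]_(n1 + n2) := block_mx L1 0 0 L2 in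
  let xi : 'I_N -> 'cV[R]_N -> 'cV[R]_(n1 + n2) :=
    fun i u => col_mx (xi1 i u) (xi2 i u) in
  let Om : 'cV[R]_N -> 'M[R]_(n1 + n2) :=
    fun u => block_mx (O11 u) (O12 u) (O21 u) (O22 u) in
  let OX : 'cV[R]_N -> 'M[R]_(D, n1 + n2) :=
    fun u => row_mx (OX1 u) (OX2 u) in
  let OH : 'cV[R]_N -> 'cV[R]_(n1 + n2) :=
    fun u => col_mx (OH1 u) (OH2 u) in
  open U ->
  is_net U S ->
  symmetric_coeffs U (rotation S) ->
  direct_system U (rotation S) xi1 ->
  direct_system U (rotation S) xi2 ->
  potential U xi1 (star xi1 L1) O11 ->
  potential U xi1 (star xi2 L2) O12 ->
  potential U xi2 (star xi1 L1) O21 ->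
  potential U xi2 (star xi2 L2) O22 ->
  potential U (tangent S) (star xi1 L1) OX1 ->
  potential U (tangent S) (star xi2 L2) OX2 ->
  potential U xi1 (as_row (lame S)) OH1 ->
  potential U xi2 (as_row (lame S)) OH2 ->
  (forall u, U u -> L^T *m Om u = (Om u)^T *m L) ->
  (forall u, U u -> Om u \in unitmx) ->
  (forall u, U u -> O22 u \in unitmx) ->
  let Shat := vsft S xi L Om OX OH in
  let S' := vsft S xi2 L2 O22 OX2 OH2 in
  let xi1' := transform_col xi2 O22 xi1 O12 in
  let xi1s' := transform_row (star xi2 L2) O22 (star xi1 L1) O21 in
  let O11' := transform_pot O22 O11 O12 O21 in
  let OX1' := transform_pot O22 OX1 OX2 O21 in
  let OH1' := transform_pot O22 OH1 O12 OH2 in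
  let S'' := vsft S' xi1' L1 O11' OX1' OH1' in
  (vsft_requirements U S xi2 L2 O22 OX2 OH2) /\
  (is_net U S' /\
   (forall i u, U u -> xi1s' i u = star xi1' L1 i u) /\
   vsft_requirements U S' xi1' L1 O11' OX1' OH1') /\
  (forall i j, i != j -> forall u, U u -> rotation Shat i j u = rotation S'' i j u) /\
  (forall i u, U u -> tangent Shat i u = tangent S'' i u) /\
  (forall i u, U u -> lame Shat i u = lame S'' i u) /\
  (forall u, U u -> position Shat u = position S'' u).
Proof.
move=> L xi Om OX OH openU netS sym dxi1 dxi2 p11 p12 p21 p22 pX1 pX2 pH1 pH2.
move=> LOm uOm u22 Shat S' xi1' xi1s' O11' OX1' OH1' S''.
(* Since [L] is block diagonal, its constraint splits into four; the off-diagonal ones link [O12] to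
   [O21] and make step 2 admissible. *)
have LO u : U u -> [/\ L1^T *m O11 u = (O11 u)^T *m L1,
    L1^T *m O12 u = (O21 u)^T *m L2, L2^T *m O21 u = (O12 u)^T *m L1 &
    L2^T *m O22 u = (O22 u)^T *m L2].
  move=> /LOm; rewrite /L /Om !tr_block_mx !mulmx_block !trmx0.
  by rewrite !mul0mx !mulmx0 !addr0 !add0r => /eq_block_mx.
have V22 u : U u -> (invmx (O22 u))^T *m L2^T = L2 *m invmx (O22 u).
  by move=> Uu; have [_ _ _ ?] := LO u Uu; apply: trmx_mul_invmx; rewrite ?u22.
have req2 : vsft_requirements U S xi2 L2 O22 OX2 OH2.
  by split=> // u /LO[].
have dxi2s := adjoint_star openU L2 sym dxi2.
have netS' := is_net_vsft openU netS req2.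
(* Transposition produces [O22^-T O12^T L1], which is [O22^-T L2^T O21] by the constraint and
   [L2 O22^-1 O21] by symmetry. *)
have xi1sE i u : U u -> xi1s' i u = star xi1' L1 i u.
  move=> Uu; have [_ _ L21 _] := LO u Uu.
  rewrite /xi1s' /xi1' /transform_row /star /transform_col linearB /= mulmxBl.
  by rewrite !trmx_mul -!mulmxA -L21 [_^T *m (L2^T *m _)]mulmxA V22// !mulmxA.
have req1 : vsft_requirements U S' xi1' L1 O11' OX1' OH1'.
  split.
  - by apply: symmetric_transform_rot => // u /LO[].
  - exact: direct_transform_col.
  (* The transformation rule yields a potential for the covectors [xi1s'], which are then exchanged
     for [star xi1' L1]. *)
  - by apply: eq_potential xi1sE _; exact: potential_transform_pot.
  - by apply: eq_potential xi1sE _; exact: potential_transform_pot.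
  - by rewrite as_row_lame_vsft; exact: potential_transform_pot.
  - by move=> u Uu; apply: schur_unitmx (u22 u Uu) (uOm u Uu).
  (* The corrections on both sides reduce to [O21^T L2 O22^-1 O21]. *)
  - move=> u Uu; have [L11 L12 L21 _] := LO u Uu.
    rewrite /O11' /transform_pot mulmxBr linearB /= mulmxBl L11 !trmx_mul.
    rewrite -!mulmxA -L21 [_^T *m (L2^T *m _)]mulmxA V22//.
    by rewrite !mulmxA L12.
have starE i u : star xi L i u = row_mx (star xi1 L1 i u) (star xi2 L2 i u).
  by rewrite /star /xi tr_col_mx mul_row_block !mulmx0 addr0 add0r.
split=> //; split=> //; split; [|split; [|split]].
(* Block elimination produces the row [xi1s']; [xi1sE] matches it with the [star xi1' L1] of step
   2. *)
- move=> i j ij u Uu; rewrite /= starE mul_row_invmx_block_col ?u22 ?uOm//.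
  by rewrite mxE opprD addrA -xi1sE.
- move=> i u Uu; rewrite /= /transform_col -[OX u]/(row_mx _ _).
  by rewrite mul_row_invmx_block_col ?u22 ?uOm// opprD addrA.
- move=> i u Uu; rewrite /= starE mul_row_invmx_block_col ?u22 ?uOm//.
  by rewrite mxE opprD addrA -xi1sE.
- move=> u Uu; rewrite /= /transform_pot.
  by rewrite mul_row_invmx_block_col ?u22 ?uOm// opprD addrA.
Qed.
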